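(* Let $\phi(x)\equiv f(x)+g(Ax)$ satisfy the standing assumptions (S1) and (S2) given in the context, let $\alpha>0$ and $r>0$, and let $X$ be a solution on $\mathcal I=[0,T]\subset\mathbb{R}_+$ of the differential inclusion $$\alpha^{-1}A^TA\big[\ddot X(t)+r\dot X(t)\big]\in-\partial\phi(X(t)),\qquad X(0)=x_0\in\operatorname{dom}\phi,\quad\dot X(0)=0 .$$ If $\phi$ is convex, then there is a constant $C>0$ such that for almost all $t\in\mathcal I$ with $t\ge t_0\equiv1/r$ $$\phi(X(t))-\phi^\star\le\frac{C}{\alpha t}.$$ If $\phi$ is $\mu$-strongly convex, then there is a constant $C>0$ such that for almost all $t\in\mathcal I$ $$\|X(t)-x^\star\|^2\le\frac{C}{\mu}\exp\!\Big(-\frac{2rt}{3}\Big),$$ provided the damping coefficient obeys $$r\le\bar r\equiv\frac{3\sqrt{\alpha\mu}}{2\,\sigma_1(A)} .$$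
   Context: Here $f:\mathbb{R}^n\to\mathbb{R}\cup\{+\infty\}$, $g:\mathbb{R}^m\to\mathbb{R}\cup\{+\infty\}$, $A\in\mathbb{R}^{m\times n}$. For a function $h$ with $\operatorname{dom}h=\{x:h(x)<\infty\}$, $\partial h(x)=\{v: h(y)-h(x)\ge\langle v,y-x\rangle\ \forall y\in\operatorname{dom}h\}$ for $x\in\operatorname{dom}h$. The function $h$ is $\mu$-strongly convex ($\mu>0$) if $h(y)\ge h(x)+\langle v,y-x\rangle+(\mu/2)\|y-x\|^2$ for all $x,y\in\operatorname{dom}h$ and all $v\in\partial h(x)$; it is convex if this holds with $\mu=0$. $\phi^\star=\min_x\phi(x)$, $x^\star$ is a minimizer of $\phi$, and $\sigma_1(A)$ is the largest singular value of $A$. Constants are independent of $t$. Standing assumptions. (S1) $f$ and $g$ are closed (closed epigraph) and convex, and $\phi$ has a finite global minimum; $A$ has full column rank. The paper takes this to include that $f,g$ are proper and lower semicontinuous and $0\in\operatorname{int}(\operatorname{dom}g-A\operatorname{dom}f)$, so that $\partial\phi(x)=\partial f(x)+A^T\partial g(Ax)$. (S2) There are constants $c>0$, $L>0$ such that every $\xi\in\partial\phi(x)$ satisfies $\|\xi\|\le c(1+\|x\|)$, and $\langle\xi_y-\xi_x,y-x\rangle\le L\|y-x\|^2$ for all $x,y$ and all $\xi_x\in\partial\phi(x)$, $\xi_y\in\partial\phi(y)$. A solution of a second-order differential inclusion is understood through its first-order form: $X$ and $\dot X$ are absolutely continuous on $\mathcal I$ and the inclusion holds for almost all $t\in\mathcal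 I$. *)

(* Defs.v *)
From HB Require Import structures.
From mathcomp Require Import all_boot all_order all_algebra.
From mathcomp Require Import all_classical all_reals all_analysis.

Set Implicit Arguments.
Unset Strict Implicit.
Unset Printing Implicit Defensive.

Import Order.TTheory GRing.Theory Num.Theory.
Import numFieldNormedType.Exports.

Local Open Scope classical_set_scope.
Local Open Scope ring_scope.

(* The library norm on matrices is the max norm, so the Euclidean structure of
   R^n = 'cV[R]_n is defined here; the two norms induce the same topology. *)
Definition dotp {R : realType} {n : nat} (u v : 'cV[R]_n) : R :=
  \sum_(i < n) u i 0 * v i 0.

Definition enorm {R : realType} {n : nat} (u : 'cV[R]_n) : R :=
  Num.sqrt (dotp u u).

(* Mathematically a maximum: the set is finite, and nonempty when 0 < n. *)
Definition sigma1 {R : realType} {m n : nat} (A : 'M[R]_(m, n)) : R :=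
  sup [set s : R | 0 <= s /\ eigenvalue (A^T *m A) (s ^+ 2)].

Section ConvexAnalysis.
Context {R : realType} {n : nat}.
Implicit Types h : 'cV[R]_n -> \bar R.

Definition edom h : set 'cV[R]_n := [set x | (h x < +oo)%E].

(* The first conjunct says that h takes its values in R U {+oo}. *)
Definition proper h : Prop :=
  (forall x, (-oo < h x)%E) /\ edom h !=set0.

Definition epigraph h : set ('cV[R]_n * R) := [set p | (h p.1 <= p.2%:E)%E].

Definition convex_ext h : Prop :=
  forall (x y : 'cV[R]_n) (s : R), 0 < s < 1 ->
    (h (s *: x + (1 - s) *: y)%R <= s%:E * h x + (1 - s)%R%:E * h y)%E.

(* Empty outside the domain of h. *)
Definition subdiff h (x : 'cV[R]_n) : set 'cV[R]_n :=
  [set v | edom h x /\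
    forall y, edom h y -> ((dotp v (y - x)%R)%:E <= h y - h x)%E].

Definition strongly_convex (mu : R) h : Prop :=
  forall x y v : 'cV[R]_n, edom h x -> edom h y -> subdiff h x v ->
    (h x + (dotp v (y - x) + mu / 2 * enorm (y - x) ^+ 2)%R%:E <= h y)%E.

Definition minimizer h (x : 'cV[R]_n) : Prop := forall y, (h x <= h y)%E.

Definition minval h : \bar R := ereal_inf (range h).

Definition subgradient_growth h : Prop :=
  exists c L : R, [/\ 0 < c, 0 < L,
    forall x xi, subdiff h x xi -> enorm xi <= c * (1 + enorm x) &
    forall x y xi_x xi_y, subdiff h x xi_x -> subdiff h y xi_y ->
      dotp (xi_y - xi_x) (y - x) <= L * enorm (y - x) ^+ 2].

End ConvexAnalysis.

Definition composite {R : realType} {m n : nat} (f : 'cV[R]_n -> \bar R)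
    (g : 'cV[R]_m -> \bar R) (A : 'M[R]_(m, n)) : 'cV[R]_n -> \bar R :=
  fun x => (f x + g (A *m x)%R)%E.

Definition closed_proper_convex {R : realType} {n : nat}
    (h : 'cV[R]_n -> \bar R) : Prop :=
  [/\ proper h, closed (epigraph h), lower_semicontinuous h & convex_ext h].

(* The qualification condition 0 \in int (dom g - A dom f) is the one that
   yields the sum rule for the subdifferential of composite f g A. *)
Definition composite_setting {R : realType} {m n : nat}
    (f : 'cV[R]_n -> \bar R) (g : 'cV[R]_m -> \bar R)
    (A : 'M[R]_(m, n)) : Prop :=
  [/\ closed_proper_convex f, closed_proper_convex g,
      \rank A = n,
      interior [set y - A *m x | y in edom g & x in edom f] 0 &
      exists x, composite f g A x \is a fin_num
                /\ minimizer (composite f g A) x].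

Definition abs_cont {R : realType} {n : nat} (a b : R)
    (F : R -> 'cV[R]_n) : Prop :=
  forall e : R, 0 < e -> exists2 d : R, 0 < d &
    forall (k : nat) (u v : 'I_k -> R),
      (forall i, a <= u i /\ u i <= v i /\ v i <= b) ->
      trivIset setT (fun i => `]u i, v i[%classic) ->
      \sum_(i < k) (v i - u i) < d ->
      \sum_(i < k) enorm (F (v i) - F (u i)) < e.

(* First-order form of
     alpha^-1 A^T A (X'' + r X') \in - subdiff phi X,  X 0 = x0,  X' 0 = 0
   on [0, T]: V stands for X' and W for X''. *)
Definition solution {R : realType} {m n : nat} (phi : 'cV[R]_n -> \bar R)
    (A : 'M[R]_(m, n)) (alpha r : R) (x0 : 'cV[R]_n) (T : R)
    (X : R -> 'cV[R]_n) : Prop :=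
  exists V : R -> 'cV[R]_n,
    [/\ abs_cont 0 T X, abs_cont 0 T V, X 0 = x0, V 0 = 0 &
        {ae (@lebesgue_measure R), forall t : R, 0 <= t <= T ->
          is_derive t 1 X (V t) /\
          exists2 W : 'cV[R]_n, is_derive t 1 V W &
            subdiff phi (X t)
              (- (alpha^-1 *: (A^T *m A *m (W + r *: V t))))}].

(* Main.v *)
Require Import Defs.
From HB Require Import structures.
From mathcomp Require Import all_boot all_order all_algebra.
From mathcomp Require Import all_classical all_reals all_analysis.
From mathcomp Require Import measurable_realfun.
From mathcomp Require Import ring lra.

(* Write y = X - xstar, <u, v>_M = alpha^-1 <A u, A v> and Phi = phi(X) - phi(xstar).
   The convex rate follows from the decrease of
     (t + 1/(2r)) (Phi + |X'|_M^2 / 2) + r/2 |y + X'/r|_M^2 + Phi/r,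
   the strongly convex one, with k = 2r/3, from the decrease of
     exp(k t) (Phi + k^2/4 |y|_M^2 + k <y, X'>_M + |X'|_M^2 / 2),
   where the bound on r says k^2 |y|_M^2 <= mu |y|^2.  Both energies are
   absolutely continuous and are differentiated almost everywhere; the chain
   rule (phi o X)' = <xi, X'> for xi in the subdifferential of phi at X comes
   from the one-sided Lipschitz bound in (S2), and (S2) also makes phi o X
   finite and absolutely continuous on the whole interval. *)

Import Order.TTheory GRing.Theory Num.Theory.
Import numFieldNormedType.Exports.

Local Open Scope classical_set_scope.
Local Open Scope ring_scope.

(** * Absolutely continuous functions *)

(** Keeping the increment [D u v] abstract lets one set of estimates serve scalar functions and
    vector curves alike: [abs_cont] unfolds to the instance [enorm (F v - F u)]. *)
Definition ac_incr {R : realType} (a b : R) (D : R -> R -> R) : Prop :=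
  forall e : R, 0 < e -> exists2 d : R, 0 < d &
    forall (k : nat) (u v : 'I_k -> R),
      (forall i, a <= u i /\ u i <= v i /\ v i <= b) ->
      trivIset setT (fun i => `]u i, v i[%classic) ->
      \sum_(i < k) (v i - u i) < d ->
      \sum_(i < k) D (u i) (v i) < e.

Definition ac {R : realType} (a b : R) (F : R -> R) : Prop :=
  ac_incr a b (fun u v => `|F v - F u|).

Section AbsoluteContinuity.
Context {R : realType} (a b : R).
Implicit Types (D : R -> R -> R) (F G : R -> R).

Lemma ac_incr_le D D' :
  (forall u v, a <= u -> u <= v -> v <= b -> D u v <= D' u v) ->
  ac_incr a b D' -> ac_incr a b D.
Proof.
move=> DD' acD e /acD[d d0 H]; exists d => // k u v uv tI sd.
apply: le_lt_trans (H k u v uv tI sd).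
by apply: ler_sum => i _; have [? [? ?]] := uv i; exact: DD'.
Qed.

Lemma ac_incrD D D' :
  ac_incr a b D -> ac_incr a b D' -> ac_incr a b (fun u v => D u v + D' u v).
Proof.
move=> acD acD' e e0.
have [d d0 H] := acD _ (divr_gt0 e0 (ltr0n R 2)).
have [d' d'0 H'] := acD' _ (divr_gt0 e0 (ltr0n R 2)).
exists (Num.min d d'); first by rewrite lt_min d0.
move=> k u v uv tI; rewrite lt_min => /andP[sd sd'].
by rewrite big_split/= (splitr e) ltrD ?H ?H'.
Qed.

Lemma ac_incrZ (K : R) D :
  0 <= K -> ac_incr a b D -> ac_incr a b (fun u v => K * D u v).
Proof.
move=> K0 acD e e0.
(* Dividing by [K + 1] instead of [K] covers [K = 0]; as [D] is not assumed nonnegative, the sign of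
   the sum is split below. *)
have [|d d0 H] := acD (e / (K + 1)); first by rewrite divr_gt0// ltr_wpDl.
exists d => // k u v uv tI sd.
rewrite -mulr_sumr; have := H k u v uv tI sd.
rewrite ltr_pdivlMr ?ltr_wpDl// => He.
have [S0|S0] := leP 0 (\sum_(i < k) D (u i) (v i)); first by nra.
by rewrite (le_lt_trans _ e0)// mulr_ge0_le0// ltW.
Qed.

Lemma ac_id : ac a b id.
Proof.
move=> e e0; exists e => // k u v uv _ sd.
suff -> : \sum_(i < k) `|id (v i) - id (u i)| = \sum_(i < k) (v i - u i) by [].
by apply: eq_bigr => i _; have [_ [? _]] := uv i; rewrite ger0_norm ?subr_ge0.
Qed.

Lemma ac_incr_small D (e : R) : ac_incr a b D -> 0 < e -> exists2 d : R, 0 < d &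
  forall u v, a <= u -> u <= v -> v <= b -> v - u < d -> D u v < e.
Proof.
move=> acD /acD[d d0 H]; exists d => // u v au uv vb vud.
have := H 1 (fun=> u) (fun=> v); rewrite !big_ord1; apply => //.
by move=> i j _ _ _; rewrite (ord1 i) (ord1 j).
Qed.

(** Across any length below some [d], [F] changes by less than 1, and a fixed number of steps of
    length [d / 2] reaches every point from [a]. *)
Lemma ac_bounded F : ac a b F -> exists B : R, forall t, a <= t <= b -> `|F t| <= B.
Proof.
move=> acF; have [d d0 H] := ac_incr_small _ _ acF (@ltr01 R).
have Hn (n : nat) t : a <= t <= b -> t <= a + n%:R * (d / 2) ->
    `|F t| <= `|F a| + n%:R.
  elim: n t => [|n IH] t /andP[at_ tb] tn.
    suff -> : t = a by rewrite addr0.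
    by apply/eqP; rewrite eq_le at_ andbT; move: tn; rewrite mul0r addr0.
  have [s [as_ st sd sn]] : exists s, [/\ a <= s, s <= t, t - s < d &
      s <= a + n%:R * (d / 2)].
    exists (Num.max a (t - d / 2)).
    have n0 : 0 <= n%:R * (d / 2) by rewrite mulr_ge0// divr_ge0// ltW.
    move: tn; rewrite -natr1 mulrDl mul1r => tn.
    by split; rewrite maxElt; case: ifPn; rewrite -?leNgt; lra.
  have := IH s; rewrite as_ (le_trans st tb) => /(_ isT sn).
  have := H s t as_ st tb sd; have := ler_normD (F t - F s) (F s).
  by rewrite subrK -natr1; lra.
pose n := (Num.truncn ((b - a) / (d / 2))).+1.
exists (`|F a| + n%:R) => t /andP[at_ tb]; apply: Hn; rewrite ?at_//.
have ba : 0 <= (b - a) / (d / 2).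
  by rewrite divr_ge0 ?subr_ge0 ?(le_trans at_)// divr_ge0// ltW.
have := truncn_itv ba; rewrite ltr_pdivrMr ?divr_gt0// => /andP[_].
by rewrite /n; lra.
Qed.

Lemma ac_cst (c : R) : ac a b (fun=> c).
Proof.
move=> e e0; exists 1 => // k u v _ _ _.
by rewrite big1// => i _; rewrite subrr normr0.
Qed.

Lemma acD F G : ac a b F -> ac a b G -> ac a b (F + G).
Proof.
move=> acF acG; apply: ac_incr_le (ac_incrD _ _ acF acG) => u v _ _ _.
by apply: le_trans (ler_normD _ _); rewrite opprD addrACA.
Qed.

Lemma acM F G : ac a b F -> ac a b G -> ac a b (F * G).
Proof.
move=> acF acG.
have [B FB] := ac_bounded _ acF; have [C GC] := ac_bounded _ acG.
apply: ac_incr_le (ac_incrD _ _ (ac_incrZ `|B| _ (normr_ge0 _) acG)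
                               (ac_incrZ `|C| _ (normr_ge0 _) acF)).
move=> u v au uv vb /=.
have -> : (F * G) v - (F * G) u = F v * (G v - G u) + G u * (F v - F u).
  by rewrite !fctE; ring.
apply: le_trans (ler_normD _ _) _; rewrite !normrM.
have Fv : `|F v| <= `|B|.
  by apply: le_trans (ler_norm B); apply: FB; rewrite vb (le_trans au).
have Gu : `|G u| <= `|C|.
  by apply: le_trans (ler_norm C); apply: GC; rewrite au (le_trans uv).
by rewrite lerD// ler_wpM2r.
Qed.

Lemma ac_sum n (F : 'I_n -> R -> R) :
  (forall i, ac a b (F i)) -> ac a b (\sum_(i < n) F i).
Proof.
move=> acF; elim/big_ind : _ => [|G H|i _]; [exact: ac_cst|exact: acD|exact: acF].
Qed.

Lemma ac_incr_sub (a' b' : R) D : a <= a' -> b' <= b ->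
  ac_incr a b D -> ac_incr a' b' D.
Proof.
move=> aa' bb' acD e /acD[d d0 H]; exists d => // k u v uv; apply: H => i.
have [a'u [uvi vb']] := uv i.
by split; [exact: le_trans a'u|split => //; exact: le_trans bb'].
Qed.

End AbsoluteContinuity.

(** * Monotonicity from the sign of the derivative almost everywhere *)

Section Monotonicity.
Context {R : realType}.
Local Notation mu := (@lebesgue_measure R).

(** At the supremum of the points where [P] holds, the local hypothesis carries [P] from a nearby
    point on its left to [min b (sup S + d / 2)]. This point cannot exceed the supremum, which is
    therefore [b]. *)
Lemma cousin_induction (a b : R) (P : R -> Prop) : a <= b -> P a ->
  (forall s, a <= s <= b -> exists2 d : R, 0 < d & forall u v, s - d < u ->
     a <= u -> u <= s -> s <= v -> v <= b -> v < s + d -> P u -> P v) ->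
  P b.
Proof.
move=> ab Pa H; pose S := [set s | a <= s <= b /\ P s].
have Sa : S a by rewrite /S/= lexx.
have supS : has_sup S by split; [exists a|exists b => s [/andP[]]].
have ac_ : a <= sup S by apply: ub_le_sup => //; exact: supS.2.
have cb : sup S <= b by apply: ge_sup; [exists a|move=> s [/andP[]]].
have [d d0 Hd] := H (sup S) (introT andP (conj ac_ cb)).
have [u Su ud] := sup_adherent d0 supS.
have uc : u <= sup S by apply: ub_le_sup => //; exact: supS.2.
set v := Num.min b (sup S + d / 2).
have cv : sup S <= v by rewrite le_min cb lerDl divr_ge0// ltW.
have vb : v <= b by rewrite ge_min lexx.
have Pv : P v.
  apply: (Hd u) => //; last exact: Su.2; first by case/andP: Su.1.
  by rewrite gt_min; apply/orP; right; lra.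
have : v <= sup S.
  by apply: ub_le_sup; [exact: supS.2|rewrite /S/= vb (le_trans ac_ cv)].
rewrite {1}/v ge_min => /orP[bc|]; last by lra.
by have -> : b = v by apply/eqP; rewrite eq_le vb (le_trans bc cv).
Qed.

(** An interval straddling [s] is cut at [s]; on both halves the slope towards [s] is continuous at
    [s] with value [D <= 0], hence below [e] nearby. *)
Lemma is_derive_le0_slope (F : R -> R) (s D e : R) :
  is_derive s 1 F D -> D <= 0 -> 0 < e ->
  exists2 d : R, 0 < d & forall u v, s - d < u -> u <= s -> s <= v -> v < s + d ->
    F v - F u <= e * (v - u).
Proof.
move=> /is_derive1_caratheodory[g [Fg gc gs]] D0 e0.
have : \forall z \near s, g z < e.
  by apply: (cvgr_lt _ gc); rewrite gs (le_lt_trans D0).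
move=> /nbhs_ballP[d /= d0 Hd]; exists d => // u v su us sv vs.
have gu : g u < e by apply: Hd; rewrite /ball/= ltr_norml; apply/andP; split; lra.
have gv : g v < e by apply: Hd; rewrite /ball/= ltr_norml; apply/andP; split; lra.
have := Fg u; have := Fg v; nra.
Qed.

Lemma negligible_open_cover (N : set R) (e : R) : mu.-negligible N -> 0 < e ->
  exists U, [/\ open U, N `<=` U & (mu U < e%:E)%E].
Proof.
move=> [B [mB B0 NB]] e0.
have [|U [oU BU Ue]] := @lebesgue_regularity_outer R B e mB _ e0.
  by rewrite [X in (X < _)%E]B0 ltry.
exists U; split=> //; first exact: subset_trans BU.
have mU : measurable U by exact: open_measurable.
rewrite -(setDUK BU) measureU //; first 1 last.
- exact: measurableD.
- by rewrite setDIK.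
by rewrite [X in (X + _ < _)%E]B0 add0e.
Qed.

(* A point of the exceptional null set lies in an open set U of small measure,
   so the subintervals tagged there contribute little to the variation of F;
   near every other point F increases by at most e times the length.  A Cousin
   type induction along [a, b] glues these two kinds of intervals. *)
Lemma ac_nonincreasing (a b : R) (F : R -> R) : a <= b -> ac a b F ->
  {ae mu, forall t : R, a < t < b -> exists2 D : R, is_derive t 1 F D & D <= 0} ->
  F b <= F a.
Proof.
move=> ab acF aeF; apply/ler_addgt0Pr => e e0.
(* The slope part then costs at most [e / 2] over the whole interval; the [+ 1] keeps the
   denominator positive when [a = b]. *)
pose e1 := e / 2 / (b - a + 1).
have e10 : 0 < e1 by rewrite !divr_gt0// ltr_wpDl// subr_ge0.
have [d d0 Hd] := acF _ (divr_gt0 e0 (ltr0n R 2)).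
have nab (x : R) : mu.-negligible [set x].
  by apply/negligibleP => //; exact: lebesgue_measure_set1.
(* The endpoints join the exceptional set because the derivative is only controlled in the open
   interval. *)
have [U [oU NU Ud]] := negligible_open_cover _ _
  (negligibleU (negligibleU aeF (nab a)) (nab b)) d0.
have mU : measurable U by exact: open_measurable.
(* Invariant of the induction: up to [s], the growth of [F] is paid for by slope [e1] and by ordered
   intervals whose total length is at most the measure of [U] before [s]. *)
pose P s := exists k (u v : nat -> R),
  [/\ forall i, (i < k)%N -> a <= u i /\ u i <= v i /\ v i <= s,
      forall i j, (i < j < k)%N -> v i <= u j,
      ((\sum_(i < k) (v i - u i))%:E <= mu (U `&` `[a, s[))%E &
      F s - F a <= e1 * (s - a) + \sum_(i < k) `|F (v i) - F (u i)|].
have P_slope s t : s <= t -> F t - F s <= e1 * (t - s) -> P s -> P t.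
  move=> st Fst [k [u [v [uv vu mk Fk]]]]; exists k, u, v; split=> //.
  - by move=> i /uv[? [? vs]]; do 2!split => //; exact: le_trans st.
  - apply: le_trans mk _; apply: le_measure; rewrite ?inE.
    + by apply: measurableI => //; exact: measurable_itv.
    + by apply: measurableI => //; exact: measurable_itv.
    + apply: setIS => x /=; rewrite !in_itv/= => /andP[-> /lt_le_trans]; exact.
  - by lra.
have P_open s t : a <= s -> s <= t -> `[s, t[ `<=` U -> P s -> P t.
  move=> as_ st stU [k [u [v [uv vu mk Fk]]]].
  exists k.+1, (fun i => if i == k then s else u i),
    (fun i => if i == k then t else v i).
  have big_k (G : R -> R -> R) : \sum_(i < k.+1) G (if i == k :> nat then s else u i)
      (if i == k :> nat then t else v i) = \sum_(i < k) G (u i) (v i) + G s t.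
    rewrite big_ord_recr/= eqxx; congr (_ + _); apply: eq_bigr => i _.
    by rewrite ltn_eqF.
  split.
  - move=> i; rewrite ltnS leq_eqVlt; case: eqP => [_ _|_ /= /uv[? [? vs]]].
      by [].
    by do 2!split => //; exact: le_trans st.
  - move=> i j /andP[ij]; rewrite ltnS leq_eqVlt => /orP[/eqP jk|jk].
      by rewrite jk eqxx -jk ltn_eqF//; move: ij; rewrite jk => /uv[_ []].
    by rewrite !ltn_eqF// ?(ltn_trans ij)//; apply: vu; rewrite ij.
  - rewrite (big_k (fun u v => v - u)) EFinD.
    have -> : U `&` `[a, t[ = (U `&` `[a, s[) `|` `[s, t[.
      apply/seteqP; split=> x /=; rewrite !in_itv/=.
        move=> [Ux /andP[ax xt]]; have [xs|sx] := ltP x s.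
          by left; rewrite ax.
        by right; rewrite xt.
      move=> [[Ux /andP[ax xs]]|/andP[sx xt]].
        by split => //; rewrite ax (lt_le_trans xs).
      by split; [apply: stU; rewrite /= in_itv/= sx|rewrite xt (le_trans as_)].
    rewrite measureU//; last 2 first.
    + by apply: measurableI => //; exact: measurable_itv.
    + apply/seteqP; split=> x //=; rewrite !in_itv/= => -[[_ /andP[_ xs]] /andP[sx _]].
      by move: (lt_le_trans xs sx); rewrite ltxx.
    apply: leeD => //; have -> : ((t - s)%:E = mu `[s, t[)%E => //.
    rewrite lebesgue_measure_itv/= lte_fin; case: ltP => [|ts]; first by [].
    by congr _%:E; lra.
  - rewrite (big_k (fun u v => `|F v - F u|)).
    have := ler_norm (F t - F s); have : 0 <= e1 * (t - s); last by lra.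
    by rewrite mulr_ge0 ?subr_ge0// ltW.
have Pa : P a.
  exists 0, (fun=> a), (fun=> a); split=> //.
    by rewrite big_ord0 measure_ge0.
  by rewrite big_ord0 !subrr mulr0 addr0.
have : P b.
  apply: (cousin_induction a b P ab Pa) => s /andP[as_ sb].
  have [Us|NUs] := pselect (U s).
    have /nbhs_ballP[r /= r0 rU] : nbhs s U by exact: open_nbhs_nbhs.
    exists r => // u v su au us sv vb vs; apply: P_open => //.
      exact: le_trans sv.
    move=> x /=; rewrite in_itv/= => /andP[ux xv]; apply: rU.
    by rewrite /ball/= ltr_norml; apply/andP; split; lra.
  have [D FD D0] : exists2 D, is_derive s 1 F D & D <= 0.
    apply: contrapT => nD; apply: NUs; apply: NU.
    have [->|/eqP sa] := eqVneq s a; first by left; right.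
    have [->|/eqP sb'] := eqVneq s b; first by right.
    left; left => /(_ _)/nD; apply; rewrite !lt_neqAle as_ sb !andbT.
    by rewrite eq_sym; apply/andP; split; exact/eqP.
  have [r r0 Hr] := is_derive_le0_slope _ _ _ _ FD D0 e10.
  exists r => // u v su au us sv vb vs; apply: P_slope.
    exact: le_trans sv.
  exact: Hr.
move=> [k [u [v [uv vu mk Fk]]]].
have sd : \sum_(i < k) (v i - u i) < d.
  rewrite -lte_fin; apply: le_lt_trans mk (le_lt_trans _ Ud).
  apply: le_measure; rewrite ?inE//.
  by apply: measurableI => //; exact: measurable_itv.
have tI : trivIset setT (fun i : 'I_k => `]u i, v i[%classic).
  apply/trivIsetP => i j _ _ ij; apply/seteqP; split=> x //=.
  rewrite !in_itv/= => -[/andP[ui vi] /andP[uj vj]].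
  have [lij|lij|lij] := ltngtP i j.
  - have := vu i j; rewrite lij ltn_ord => /(_ isT); lra.
  - have := vu j i; rewrite lij ltn_ord => /(_ isT); lra.
  - by move/eqP: ij; apply; exact: val_inj.
have := Hd k _ _ (fun i => uv i (ltn_ord i)) tI sd.
have : e1 * (b - a) <= e / 2.
  have : e1 * (b - a + 1) = e / 2 by rewrite /e1 divfK// gt_eqF// ltr_wpDl// subr_ge0.
  by lra.
by lra.
Qed.

End Monotonicity.

(** * Euclidean structure and largest singular value *)

Section Euclidean.
Context {R : realType}.

Lemma dotpC n (u v : 'cV[R]_n) : dotp u v = dotp v u.
Proof. by apply: eq_bigr => i _; rewrite mulrC. Qed.

Lemma dotpDl n (u v w : 'cV[R]_n) : dotp (u + v) w = dotp u w + dotp v w.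
Proof. by rewrite -big_split; apply: eq_bigr => i _; rewrite mxE mulrDl. Qed.

Lemma dotpZl n (a : R) (u v : 'cV[R]_n) : dotp (a *: u) v = a * dotp u v.
Proof. by rewrite mulr_sumr; apply: eq_bigr => i _; rewrite mxE mulrA. Qed.

Lemma dotpNl n (u v : 'cV[R]_n) : dotp (- u) v = - dotp u v.
Proof. by rewrite -scaleN1r dotpZl mulN1r. Qed.

Lemma dotpDr n (u v w : 'cV[R]_n) : dotp u (v + w) = dotp u v + dotp u w.
Proof. by rewrite dotpC dotpDl !(dotpC _ u). Qed.

Lemma dotpZr n (a : R) (u v : 'cV[R]_n) : dotp u (a *: v) = a * dotp u v.
Proof. by rewrite dotpC dotpZl dotpC. Qed.

Lemma dotpNr n (u v : 'cV[R]_n) : dotp u (- v) = - dotp u v.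
Proof. by rewrite dotpC dotpNl dotpC. Qed.

Lemma dotpBl n (u v w : 'cV[R]_n) : dotp (u - v) w = dotp u w - dotp v w.
Proof. by rewrite dotpDl dotpNl. Qed.

Lemma dotpBr n (u v w : 'cV[R]_n) : dotp u (v - w) = dotp u v - dotp u w.
Proof. by rewrite dotpDr dotpNr. Qed.

Lemma dotp0l n (u : 'cV[R]_n) : dotp 0 u = 0.
Proof. by rewrite -(scale0r 0) dotpZl mul0r. Qed.

Lemma dotp0r n (u : 'cV[R]_n) : dotp u 0 = 0.
Proof. by rewrite dotpC dotp0l. Qed.

Lemma dotp_ge0 n (u : 'cV[R]_n) : 0 <= dotp u u.
Proof. by apply: sumr_ge0 => i _; rewrite -expr2 sqr_ge0. Qed.

Lemma dotp_eq0 n (u : 'cV[R]_n) : dotp u u = 0 -> u = 0.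
Proof.
move=> /eqP; rewrite /dotp psumr_eq0 => [/allP u0|k _].
  apply/matrixP => i j; rewrite ord1 mxE; apply/eqP; rewrite -sqrf_eq0 expr2.
  by have := u0 i; rewrite mem_index_enum => /(_ isT).
by rewrite -expr2 sqr_ge0.
Qed.

Lemma dotp_mulmx m n (A : 'M[R]_(m, n)) u v : dotp (A *m u) v = dotp u (A^T *m v).
Proof.
rewrite /dotp; under eq_bigr do rewrite mxE mulr_suml.
rewrite exchange_big/=; apply: eq_bigr => j _.
by rewrite mxE mulr_sumr; apply: eq_bigr => i _; rewrite mxE; ring.
Qed.

Lemma enorm_ge0 n (u : 'cV[R]_n) : 0 <= enorm u.
Proof. exact: sqrtr_ge0. Qed.

Lemma enorm_sqr n (u : 'cV[R]_n) : enorm u ^+ 2 = dotp u u.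
Proof. by rewrite sqr_sqrtr// dotp_ge0. Qed.

Lemma enormN n (u : 'cV[R]_n) : enorm (- u) = enorm u.
Proof. by rewrite /enorm dotpNl dotpNr opprK. Qed.

Lemma enormB n (u v : 'cV[R]_n) : enorm (u - v) = enorm (v - u).
Proof. by rewrite -enormN opprB. Qed.

Lemma dotp_le_enorm n (u v : 'cV[R]_n) : dotp u v <= enorm u * enorm v.
Proof.
rewrite -(ger0_norm (mulr_ge0 (enorm_ge0 _ u) (enorm_ge0 _ v))).
apply: le_trans (ler_norm _) _.
rewrite -ler_sqr ?nnegrE// !(real_normK (num_real _)) exprMn !enorm_sqr.
have [v0|v0] := eqVneq (dotp v v) 0.
  by rewrite (dotp_eq0 _ _ v0) !dotp0r expr0n mulr0.
have vp : 0 < dotp v v by rewrite lt_neqAle eq_sym v0 dotp_ge0.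
have := dotp_ge0 _ (dotp v v *: u - dotp u v *: v).
rewrite dotpBl !dotpBr !dotpZl !dotpZr (dotpC _ v u).
set a := dotp u u; set b := dotp u v; set c := dotp v v in vp *.
have -> : c * (c * a) - c * (b * b) - (b * (c * b) - b * (b * c)) =
  c * (a * c - b ^+ 2) by ring.
by rewrite pmulr_rge0// subr_ge0.
Qed.

Lemma ler_enormD n (u v : 'cV[R]_n) : enorm (u + v) <= enorm u + enorm v.
Proof.
rewrite -ler_sqr ?nnegrE ?addr_ge0 ?enorm_ge0// sqrrD !enorm_sqr.
rewrite dotpDl !dotpDr (dotpC _ v u); have := dotp_le_enorm _ u v; lra.
Qed.

Lemma ler_entry_enorm n (u : 'cV[R]_n) i : `|u i 0| <= enorm u.
Proof.
rewrite -ler_sqr ?nnegrE ?enorm_ge0// enorm_sqr (real_normK (num_real _)) expr2 /dotp.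
rewrite (bigD1 i)//= lerDl.
by apply: sumr_ge0 => j _; rewrite -expr2 sqr_ge0.
Qed.

Lemma ler_enorm_sum n (u : 'cV[R]_n) : enorm u <= \sum_(i < n) `|u i 0|.
Proof.
have s0 : 0 <= \sum_(i < n) `|u i 0| by apply: sumr_ge0.
rewrite -ler_sqr ?nnegrE ?enorm_ge0// enorm_sqr expr2 /dotp mulr_sumr.
apply: ler_sum => i _; rewrite -expr2 -real_normK ?num_real// expr2.
by rewrite ler_wpM2r// (bigD1 i)//= lerDl sumr_ge0.
Qed.

Lemma abs_cont_entry n (a b : R) (F : R -> 'cV[R]_n) i :
  abs_cont a b F -> ac a b (fun t => F t i 0).
Proof.
apply: (ac_incr_le _ _ _ (fun u v => enorm (F v - F u))) => u v _ _ _.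
by have := ler_entry_enorm _ (F v - F u) i; rewrite !mxE.
Qed.

Lemma abs_cont_bounded n (a b : R) (F : R -> 'cV[R]_n) : abs_cont a b F ->
  exists B : R, forall t, a <= t <= b -> enorm (F t) <= B.
Proof.
move=> acF.
have /choice[B FB] i := ac_bounded _ _ _ (abs_cont_entry _ _ _ _ i acF).
exists (\sum_(i < n) B i) => t /FB Ft; apply: le_trans (ler_enorm_sum _ _) _.
by apply: ler_sum => i _; exact: Ft.
Qed.

Lemma ac_dotp n (a b : R) (F G : R -> 'cV[R]_n) :
  abs_cont a b F -> abs_cont a b G -> ac a b (fun t => dotp (F t) (G t)).
Proof.
move=> acF acG.
have -> : (fun t => dotp (F t) (G t)) =
    \sum_(i < n) (fun t => F t i 0) * (fun t => G t i 0).
  by apply/funext => t; rewrite fct_sumE.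
by apply: ac_sum => i; apply: acM; exact: abs_cont_entry.
Qed.

Lemma is_derive_entry n (F : R -> 'cV[R]_n) (t : R) (F' : 'cV[R]_n) i :
  is_derive t 1 F F' -> is_derive t 1 (fun s => F s i 0) (F' i 0).
Proof.
move=> [dF <-]; have /derivable_mxP dFi := dF.
apply: DeriveDef; first exact: dFi.
by rewrite derive_mx// mxE.
Qed.

Lemma is_derive_dotp n (F G : R -> 'cV[R]_n) (t : R) (F' G' : 'cV[R]_n) :
  is_derive t 1 F F' -> is_derive t 1 G G' ->
  is_derive t 1 (fun s => dotp (F s) (G s)) (dotp F' (G t) + dotp (F t) G').
Proof.
move=> dF dG.
have -> : (fun t => dotp (F t) (G t)) =
    \sum_(i < n) (fun t => F t i 0) * (fun t => G t i 0).
  by apply/funext => s; rewrite fct_sumE.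
rewrite -big_split/=.
apply: is_derive_eq.
  apply: is_derive_sum => i; apply: is_deriveM; exact: is_derive_entry.
by apply: eq_bigr => i _; rewrite /GRing.scale/=; ring.
Qed.

End Euclidean.

(** * The Rayleigh quotient of [A^T *m A] and its largest eigenvalue *)

Section SpectralNorm.
Context {R : realType}.

(** Row vectors appear because the extreme value theorem [EVT_max_rV] is stated for them. *)
Lemma continuous_mulmx_dotp m n (M : 'M[R]_(m, n)) :
  continuous (fun u : 'rV[R]_n => dotp (M *m u^T) (M *m u^T)).
Proof.
apply: continuous_big => [|i _ u]; first exact: add_continuous.
suff Mi : continuous (fun v : 'rV[R]_n => (M *m v^T) i 0) by exact: cvgM (Mi u) (Mi u).
have -> : (fun v : 'rV[R]_n => (M *m v^T) i 0) =
    (fun v => \sum_(j < n) M i j * v 0 j).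
  by apply/funext => v; rewrite mxE; apply: eq_bigr => j _; rewrite mxE.
apply: continuous_big => [|j _ v]; first exact: add_continuous.
exact: cvgM (@cvg_cst _ (M i j) _ _ _) (@coord_continuous _ _ _ 0 j v).
Qed.

(** First-order condition at the minimum [t = 0] of a quadratic. *)
Lemma quadratic_lin0 (p q : R) : 0 <= p -> (forall t, 0 <= t * q + t ^+ 2 * p) -> q = 0.
Proof.
move=> p0 H; apply/eqP; rewrite -sqrf_eq0 eq_le sqr_ge0 andbT.
(* Here the quadratic equals [- (q / (p + 1)) ^+ 2]; the shift by 1 also covers [p = 0]. *)
have := H (- q / (p + 1)).
have p1 : 0 < p + 1 by rewrite ltr_wpDl.
set d := p + 1 in p1 *; have -> : p = d - 1 by rewrite /d addrK.
have -> : - q / d * q + (- q / d) ^+ 2 * (d - 1) = - (q ^+ 2 * d^-1 ^+ 2).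
  by field; rewrite gt_eqF.
by rewrite oppr_ge0 pmulr_lle0// exprn_gt0// invr_gt0.
Qed.

(* A maximizer z of the Rayleigh quotient is an eigenvector: the nonnegative
   quadratic form l |w|^2 - |A w|^2 vanishes at z, hence so does its gradient. *)
Lemma dotp_mulmx_le_sigma1 m n (A : 'M[R]_(m, n)) (y : 'cV[R]_n) :
  dotp (A *m y) (A *m y) <= sigma1 A ^+ 2 * dotp y y.
Proof.
have [->|y0] := eqVneq y 0; first by rewrite mulmx0 !dotp0r mulr0.
have dotp_gt0 (w : 'cV[R]_n) : w != 0 -> 0 < dotp w w.
  by move=> w0; rewrite lt_neqAle dotp_ge0 andbT eq_sym; apply: contra_neq w0; exact: dotp_eq0.
pose K := [set u : 'rV[R]_n | dotp u^T u^T = 1].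
have unitK (w : 'cV[R]_n) : w != 0 -> K ((enorm w)^-1 *: w^T).
  move=> /dotp_gt0 w0; rewrite /K/= linearZ/= trmxK dotpZl dotpZr mulrA -expr2.
  by rewrite exprVn enorm_sqr mulVf// gt_eqF.
have cK : compact K.
  apply: bounded_closed_compact.
    exists 1; split=> // B B1 u Ku /=; rewrite [leLHS]/Num.Def.normr/= mx_normrE.
    apply: bigmax_le; first by rewrite ltW// (lt_trans _ B1).
    move=> [i j] _ /=; rewrite ord1 (le_trans _ (ltW B1))//.
    have := ler_entry_enorm _ u^T j; rewrite mxE => /le_trans; apply.
    by rewrite /enorm Ku sqrtr1.
  have -> : K = (fun u : 'rV[R]_n => dotp (1%:M *m u^T) (1%:M *m u^T)) @^-1` [set 1].
    by apply/seteqP; split=> u /=; rewrite mul1mx.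
  by apply: preimage_closed; [move=> u _; exact: continuous_mulmx_dotp|exact: closed_eq].
have K0 : K !=set0 by exists ((enorm y)^-1 *: y^T); exact: unitK.
have [|z /set_mem Kz zmax] :=
  @EVT_max_rV _ _ (fun u : 'rV[R]_n => dotp (A *m u^T) (A *m u^T)) _ K0 cK.
  by apply: continuous_subspaceT; exact: continuous_mulmx_dotp.
set l := dotp (A *m z^T) (A *m z^T) in zmax.
have Rayleigh (w : 'cV[R]_n) : dotp (A *m w) (A *m w) <= l * dotp w w.
  have [->|w0] := eqVneq w 0; first by rewrite mulmx0 !dotp0r mulr0.
  have /zmax := mem_set (unitK _ w0).
  rewrite linearZ/= trmxK -scalemxAr dotpZl dotpZr mulrA -expr2 exprVn enorm_sqr.
  by rewrite mulrC ler_pdivrMr ?dotp_gt0.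
have grad w : l * dotp z^T w - dotp (A *m z^T) (A *m w) = 0.
  suff : 2 * (l * dotp z^T w - dotp (A *m z^T) (A *m w)) = 0 by lra.
  apply: (quadratic_lin0 (l * dotp w w - dotp (A *m w) (A *m w))).
    by rewrite subr_ge0.
  move=> t; have := Rayleigh (z^T + t *: w).
  rewrite mulmxDr -scalemxAr !(dotpDl, dotpDr, dotpZl, dotpZr).
  rewrite (dotpC _ w z^T) (dotpC _ (A *m w) (A *m z^T)).
  move: Kz; rewrite /K/= => ->; rewrite -/l; lra.
have zeig : A^T *m A *m z^T = l *: z^T.
  apply/esym/eqP; rewrite -subr_eq0; apply/eqP/dotp_eq0.
  set w := l *: z^T - _; by rewrite {1}/w dotpBl dotpZl -mulmxA dotp_mulmx trmxK grad.
have l0 : 0 <= l by exact: dotp_ge0.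
(* [Num.sqrt l] belongs to the set defining [sigma1 A], and [Rayleigh] bounds that set. As
   [eigenvalue] speaks of row eigenvectors, transposition and the symmetry of [A^T *m A] are used
   both times. *)
have sqrtl : Num.sqrt l <= sigma1 A.
  apply: ub_le_sup.
    exists (Num.sqrt l) => s [s0 /eigenvalueP[v vs v0]].
    have vT0 : v^T != 0 by rewrite -trmx0 (inj_eq trmx_inj).
    rewrite -(ger0_norm s0) -sqrtr_sqr ler_wsqrtr// -(ler_pM2r (dotp_gt0 _ vT0)).
    apply: le_trans (Rayleigh _); rewrite -dotpZl -linearZ/= -vs !trmx_mul trmxK.
    by rewrite -mulmxA [leLHS]dotp_mulmx trmxK.
  split; first exact: sqrtr_ge0.
  apply/eigenvalueP; exists z.
    by apply: trmx_inj; rewrite sqr_sqrtr// !trmx_mul trmxK zeig linearZ.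
  apply/eqP => z0; move: Kz; rewrite /K/= z0 trmx0 dotp0r => /esym/eqP.
  by rewrite oner_eq0.
apply: le_trans (Rayleigh y) _; rewrite ler_wpM2r ?dotp_ge0//.
by rewrite -(sqr_sqrtr l0) lerXn2r ?nnegrE ?sqrtr_ge0// (le_trans (sqrtr_ge0 l)).
Qed.

End SpectralNorm.

(** * Chain rule for subgradients *)

Section Chain.
Context {R : realType} {n : nat}.
Local Notation mu := (@lebesgue_measure R).

(** A real level below [f x + g x] is at most [b + c] for some reals [b] below [f x] and [c] below
    [g x], including when one of the values is [+oo]. *)
Lemma lower_semicontinuousD (T : topologicalType) (f g : T -> \bar R) :
  (forall x, -oo < f x)%E -> (forall x, -oo < g x)%E ->
  lower_semicontinuous f -> lower_semicontinuous g ->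
  lower_semicontinuous (fun x => f x + g x)%E.
Proof.
move=> fNy gNy lf lg x a afg.
have [b [c [bf cg ab]]] : exists b c, [/\ (b%:E < f x)%E, (c%:E < g x)%E & a <= b + c].
  move: afg (fNy x) (gNy x); case: (f x) => [y| |]//; case: (g x) => [z| |]//=.
  - rewrite -EFinD lte_fin => ayz _ _; exists (y - (y + z - a) / 2), (z - (y + z - a) / 2).
    by rewrite !lte_fin; split; lra.
  - move=> _ _ _; exists (y - 1), (a - (y - 1)); rewrite !lte_fin ltry.
    by split => //; lra.
  - move=> _ _ _; exists (a - (z - 1)), (z - 1); rewrite !lte_fin ltry.
    by split => //; lra.
  - by move=> _ _ _; exists a, 0; rewrite !ltry addr0.
have [U xU Uf] := lf x b bf; have [V xV Vg] := lg x c cg.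
exists (U `&` V); first exact: filterI.
move=> y [/Uf bfy /Vg cgy]; apply: le_lt_trans (lteD bfy cgy).
by rewrite -EFinD lee_fin.
Qed.

Lemma lower_semicontinuous_comp (S T : topologicalType) (f : T -> \bar R) (k : S -> T) :
  continuous k -> lower_semicontinuous f -> lower_semicontinuous (f \o k).
Proof.
move=> ck lf x a /lf[V kxV Vf]; exists (k @^-1` V); first exact: ck.
by move=> y; exact: Vf.
Qed.

Lemma negligible_dense (N : set R) (a b : R) : mu.-negligible N -> a < b ->
  exists2 t : R, a < t < b & ~ N t.
Proof.
move=> [B [mB B0 NB]] ab; apply: contrapT => H.
have sub : `]a, b[ `<=` B.
  move=> t /=; rewrite in_itv/= => tab; apply: NB; apply: contrapT => Nt.
  by apply: H; exists t.
have := le_measure mu _ _ sub; rewrite !inE => /(_ (measurable_itv _) mB).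
have muab : (mu `]a, b[ = (b - a)%:E)%E.
  by rewrite lebesgue_measure_itv/= lte_fin ab.
by rewrite [X in (X <= _)%E -> _]muab [X in (_ <= X)%E -> _]B0 lee_fin; lra.
Qed.


(** The epsilon form of the derivative, in which the two-sided squeeze of the chain rule is carried
    out. *)
Lemma is_derive1P (f : R -> R) (t D : R) : is_derive t 1 f D <->
  forall e, 0 < e -> \forall z \near t, `|f z - f t - D * (z - t)| <= e * `|z - t|.
Proof.
split=> [/is_derive1_caratheodory[g [fg gc <-]] e e0|H].
  have : \forall z \near t, `|g t - g z| <= e by move/cvgrPdist_le : gc; exact.
  apply: filterS => z gz; rewrite fg -mulrBl normrM ler_wpM2r//.
  by rewrite distrC.
apply/is_derive1_caratheodory.
exists (fun z => if z == t then D else (f z - f t) / (z - t)); split.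
- move=> z; case: eqP => [->|/eqP]; first by rewrite !subrr mulr0.
  by rewrite -subr_eq0 => /divfK ->.
- apply/cvgrPdist_le => e e0; have := H e e0; apply: filterS => z.
  rewrite eqxx; case: eqP => [-> _|/eqP]; first by rewrite subrr normr0 ltW.
  rewrite -subr_eq0 => zt Hz; have zt0 : 0 < `|z - t| by rewrite normr_gt0.
  by rewrite -(ler_pM2r zt0) distrC -normrM mulrBl divfK.
- by rewrite eqxx.
Qed.

(** Euclidean balls are contained in max-norm balls of the same radius, since each entry is bounded
    by [enorm]. *)
Lemma nbhs_enorm (x : 'cV[R]_n) (V : set 'cV[R]_n) : nbhs x V ->
  exists2 r : R, 0 < r & forall y, enorm (y - x) < r -> V y.
Proof.
move=> /nbhs_ballP[r /= r0 rV]; exists r => // y yr; apply: rV; split=> // i j.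
rewrite ord1 /ball/= distrC; apply: le_lt_trans yr.
by have := ler_entry_enorm _ (y - x) i; rewrite !mxE.
Qed.

End Chain.

(** * Regularity of [h] along a curve with subgradients at almost all times *)

Section SubgradientChainRule.
Context {R : realType} {n : nat} (h : 'cV[R]_n -> \bar R).
Local Notation mu := (@lebesgue_measure R).
Context (hNy : forall x, (-oo < h x)%E) (hlsc : lower_semicontinuous h)
  (h_growth : subgradient_growth h).

Lemma edomE x : edom h x -> h x = (fine (h x))%:E.
Proof. by move=> hx; rewrite fineK// fin_numE -ltNye -ltey hNy. Qed.

Lemma subdiff_le x y xi : subdiff h x xi -> edom h y ->
  dotp xi (y - x) <= fine (h y) - fine (h x).
Proof.
move=> [hx hxi] hy; have := hxi y hy.
by rewrite (edomE _ hx) (edomE _ hy) -EFinB lee_fin.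
Qed.

Context (T : R) (X : R -> 'cV[R]_n) (T0 : 0 < T) (acX : abs_cont 0 T X)
  (hX0 : edom h (X 0))
  (aeX : {ae mu, forall t : R, 0 <= t <= T -> exists xi, subdiff h (X t) xi}).

(** Times with a subgradient have full measure, hence are dense, and [X] is continuous. This is how
    almost-everywhere information reaches every time. *)
Lemma dense_subdiff (s : R) V (e : R) : 0 <= s <= T -> nbhs (X s) V -> 0 < e ->
  exists t xi, [/\ 0 <= t <= T, subdiff h (X t) xi, V (X t)
    & enorm (X t - X s) < e].
Proof.
move=> /andP[s0 sT] /nbhs_enorm[r r0 rV] e0.
have re0 : 0 < Num.min r e by rewrite lt_min r0.
have [d d0 Hd] := ac_incr_small _ _ (fun u v => enorm (X v - X u)) _ acX re0.
have [|t /andP[lt tu] Nt] := negligible_dense _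
    (Num.max 0 (s - d)) (Num.min T (s + d)) aeX.
  by rewrite gt_max !lt_min T0/=; lra.
move: lt tu; rewrite gt_max lt_min => /andP[t0 sd] /andP[tT td].
have [xi hxi] : exists xi, subdiff h (X t) xi.
  by apply: contrapT => nxi; apply: Nt => /=; rewrite !ltW// => /(_ isT).
suff : enorm (X t - X s) < Num.min r e.
  rewrite lt_min => /andP[tr te]; exists t, xi; split=> //; first by rewrite !ltW.
  exact: rV.
have [ts|st] := leP t s.
  by rewrite enormB; apply: Hd => //; lra.
by apply: Hd => //; lra.
Qed.

Lemma subgradient_bound : exists2 B : R, 0 < B & forall (t : R) xi, 0 <= t <= T ->
  subdiff h (X t) xi -> enorm xi <= B.
Proof.
have [c [L [c0 _ hc _]]] := h_growth.
have [B XB] := abs_cont_bounded _ _ _ _ acX.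
have B0 : 0 <= B by rewrite (le_trans (enorm_ge0 _ (X 0)))// XB// lexx ltW.
exists (c * (1 + B)); first by rewrite mulr_gt0// ltr_wpDr.
move=> t xi tT /hc; move=> /le_trans; apply; rewrite ler_pM2l// lerD2l.
exact: XB.
Qed.

(** If [h (X s)] exceeded [M], lower semicontinuity would give the same at a nearby point carrying a
    subgradient; there the subgradient inequality tested at [X 0] bounds [h] by [M]. *)
Lemma edom_curve (s : R) : 0 <= s <= T -> edom h (X s).
Proof.
move=> sT; have [B B0 hB] := subgradient_bound.
have [K XK] := abs_cont_bounded _ _ _ _ acX.
set M := fine (h (X 0)) + B * (K + K).
suff : (h (X s) <= M%:E)%E by move=> /le_lt_trans; apply; rewrite ltry.
rewrite leNgt; apply/negP => /hlsc[V sV VM].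
have [t [xi [tT hxi /VM + _]]] := dense_subdiff _ _ _ sT sV ltr01.
apply/negP; rewrite -leNgt edomE ?lee_fin; last exact: hxi.1.
have := subdiff_le _ _ _ hxi hX0.
have := dotp_le_enorm _ (- xi) (X 0 - X t); rewrite dotpNl enormN.
have : enorm xi * enorm (X 0 - X t) <= B * (K + K); last by rewrite /M; lra.
apply: ler_pM; rewrite ?enorm_ge0//; first exact: hB hxi.
apply: le_trans (ler_enormD _ _ _) _; rewrite enormN.
by rewrite lerD ?XK// lexx ltW.
Qed.

Lemma subdiff_curve_le (s t : R) xi : 0 <= s <= T -> 0 <= t <= T ->
  subdiff h (X t) xi -> dotp xi (X s - X t) <= fine (h (X s)) - fine (h (X t)).
Proof. by move=> sT tT /subdiff_le; apply; exact: edom_curve. Qed.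

(** Lower semicontinuity is one-sided: [h (X t)] is only kept from falling far below [h (X s)],
    which is the direction that upper bounds on [h (X s)] call for. *)
Lemma dense_subdiff_lsc (s e : R) : 0 <= s <= T -> 0 < e ->
  exists t xi, [/\ 0 <= t <= T, subdiff h (X t) xi,
    fine (h (X s)) - e < fine (h (X t)) & enorm (X t - X s) < e].
Proof.
move=> sT e0.
have [|V sV HV] := hlsc (X s) (fine (h (X s)) - e).
  by rewrite [ltRHS](edomE _ (edom_curve _ sT)) lte_fin; lra.
have [t [xi [tT hxi /HV Vt et]]] := dense_subdiff _ _ _ sT sV e0.
exists t, xi; split=> //.
by move: Vt; rewrite (edomE _ (edom_curve _ tT)) lte_fin.
Qed.

(** Replace [s] by a nearby time with a subgradient, use the subgradient inequality there and the
    uniform bound on subgradients, and let the error vanish. *)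
Lemma lipschitz_curve : exists2 B : R, 0 < B & forall s t : R, 0 <= s <= T ->
  0 <= t <= T -> fine (h (X s)) - fine (h (X t)) <= B * enorm (X s - X t).
Proof.
have [B B0 hB] := subgradient_bound; exists B => // s t sT tT.
apply/ler_addgt0Pr => e e0.
(* The error enters once through lower semicontinuity and [B] times through the displacement of
   [X s]. *)
have e1 : 0 < e / (1 + B) by rewrite divr_gt0// ltr_wpDr// ltW.
have [s' [xi [s'T hxi lsc_s' ss']]] := dense_subdiff_lsc _ _ sT e1.
have := subdiff_curve_le _ _ _ tT s'T hxi.
have := dotp_le_enorm _ (- xi) (X t - X s'); rewrite dotpNl enormN.
have : enorm xi * enorm (X t - X s') <= B * (enorm (X s - X t) + e / (1 + B)).
  apply: ler_pM; rewrite ?enorm_ge0//; first exact: hB hxi.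
  rewrite enormB -(subrK (X s) (X s')) -addrA.
  by apply: le_trans (ler_enormD _ _ _) _; rewrite [leRHS]addrC lerD// ltW.
have : e / (1 + B) + B * (e / (1 + B)) = e by field; rewrite gt_eqF// ltr_wpDr// ltW.
by lra.
Qed.

Lemma ac_curve : ac 0 T (fun t => fine (h (X t))).
Proof.
have [B B0 hB] := lipschitz_curve.
apply: ac_incr_le (ac_incrZ _ _ _ _ (ltW B0) acX) => u v u0 uv vT.
have uT : 0 <= u <= T by rewrite u0 (le_trans uv).
have v0T : 0 <= v <= T by rewrite vT (le_trans u0).
rewrite ler_norml; apply/andP; split; last exact: hB.
by have := hB u v uT v0T; rewrite enormB; lra.
Qed.

(** A subgradient [xi'] at a time close to [s] bounds the increment by its product with the
    displacement; the one-sided Lipschitz condition trades [xi'] for [xi] at a quadratic cost. *)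
Lemma subdiff_curve_ge : exists2 L : R, 0 < L & forall (s t : R) xi,
  0 <= s <= T -> 0 <= t <= T -> subdiff h (X t) xi ->
  fine (h (X s)) - fine (h (X t)) <=
    dotp xi (X s - X t) + L * dotp (X s - X t) (X s - X t).
Proof.
have [_ [L [_ L0 _ hL]]] := h_growth; exists L => // s t xi sT tT hxi.
apply/ler_addgt0Pr => e e0.
set D := enorm (X s - X t).
have D0 : 0 <= D by exact: enorm_ge0.
have x0 : 0 <= enorm xi by exact: enorm_ge0.
(* [K] collects the coefficients of the error [d]: 1 from lower semicontinuity, [enorm xi] from the
   linear term, and [L * (D + D + 1)] from replacing [D] by [D + d] in the square, where
   [d <= 1]. *)
pose K := 1 + enorm xi + L * (D + D + 1).
have K0 : 0 < K by rewrite /K; nra.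
have d0 : 0 < Num.min 1 (e / K) by rewrite lt_min ltr01 divr_gt0.
have [s' [xi' [s'T hxi' lsc_s' ss']]] := dense_subdiff_lsc _ _ sT d0.
set d := Num.min 1 (e / K) in d0 lsc_s' ss'.
have d1 : d <= 1 by rewrite ge_min lexx.
have de : d * K <= e by rewrite -ler_pdivlMr// ge_min lexx orbT.
have up : fine (h (X s')) - fine (h (X t)) <= dotp xi' (X s' - X t).
  have := subdiff_curve_le _ _ _ tT s'T hxi'.
  by rewrite -(opprB (X s') (X t)) dotpNr; lra.
have := hL _ _ _ _ hxi hxi'; rewrite dotpBl.
have : dotp xi (X s' - X t) <= dotp xi (X s - X t) + enorm xi * d.
  rewrite -[X s' - X t](subrKA (X s)) (dotpDr _ _ (X s' - X s)) [leLHS]addrC lerD2l.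
  by apply: le_trans (dotp_le_enorm _ _ _) _; rewrite ler_wpM2l// ltW.
have : enorm (X s' - X t) <= D + d.
  rewrite -[X s' - X t](subrKA (X s)) addrC.
  by apply: le_trans (ler_enormD _ _ _) _; rewrite lerD2l ltW.
rewrite -enorm_sqr -/D; have := enorm_ge0 _ (X s' - X t).
set D' := enorm (X s' - X t) => D'0 D'D.
have : L * D' ^+ 2 <= L * D ^+ 2 + L * (D + D + 1) * d.
  rewrite -mulrA -mulrDr ler_pM2l//.
  have : D' ^+ 2 <= (D + d) ^+ 2 by rewrite lerXn2r ?nnegrE// addr_ge0// ltW.
  by nra.
by move: de; rewrite /K; lra.
Qed.

(* The subgradient inequality bounds the increment of h along X from below,
   the one-sided Lipschitz condition on the subdifferential bounds it from
   above, with a quadratic error. *)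
Lemma is_derive_curve (t : R) xi (V : 'cV[R]_n) : 0 < t < T ->
  is_derive t 1 X V -> subdiff h (X t) xi ->
  is_derive t 1 (fun s => fine (h (X s))) (dotp xi V).
Proof.
move=> /andP[t0 tT] dX hxi; have [L L0 hL] := subdiff_curve_ge.
have tT' : 0 <= t <= T by rewrite !ltW.
have dXt : is_derive t 1 (fun s => X s - X t) V.
  by apply: is_derive_eq (is_deriveB dX (is_derive_cst (X t) t 1)) _; rewrite subr0.
have du := is_derive_dotp _ _ _ _ _ _ (is_derive_cst xi t 1) dXt.
have dw := is_derive_dotp _ _ _ _ _ _ dXt dXt.
apply/is_derive1P => e e0.
have du' : \forall z \near t,
    `|dotp xi (X z - X t) - dotp xi V * (z - t)| <= e / 2 * `|z - t|.
  apply: filterS ((is_derive1P _ _ _).1 du _ (divr_gt0 e0 (ltr0n R 2))) => z.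
  by rewrite subrr dotp0l dotp0r subr0 add0r.
(* The squared displacement has derivative 0 at [t]; with [e / (2 * L)] its multiple by [L] costs at
   most the other half of [e]. *)
have dw' : \forall z \near t,
    `|dotp (X z - X t) (X z - X t)| <= e / (2 * L) * `|z - t|.
  apply: filterS ((is_derive1P _ _ _).1 dw _
    (divr_gt0 e0 (mulr_gt0 (ltr0n R 2) L0))) => z.
  by rewrite subrr !dotp0l !dotp0r addr0 subr0 mul0r subr0.
near=> z.
have zT : 0 <= z <= T.
  have : z \in `]0, T[ by near: z; apply: near_in_itvoo; rewrite in_itv/= t0.
  by rewrite in_itv/= => /andP[/ltW -> /ltW ->].
have : `|dotp (X z - X t) (X z - X t)| <= e / (2 * L) * `|z - t| by near: z; exact: dw'.
have : `|dotp xi (X z - X t) - dotp xi V * (z - t)| <= e / 2 * `|z - t| by near: z; exact: du'.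
have lo := subdiff_curve_le _ _ _ zT tT' hxi.
have up := hL _ _ _ zT tT' hxi.
rewrite (ger0_norm (dotp_ge0 _ _)) => Hu Hw.
have {}Hw : L * dotp (X z - X t) (X z - X t) <= e / 2 * `|z - t|.
  have -> : e / 2 * `|z - t| = L * (e / (2 * L) * `|z - t|) by field; rewrite gt_eqF.
  by rewrite ler_pM2l.
move: Hu; rewrite !ler_norml => /andP[Hu1 Hu2]; apply/andP; split; last by lra.
have : 0 <= e * `|z - t| by rewrite mulr_ge0// ltW.
by lra.
Unshelve. all: by end_near.
Qed.

End SubgradientChainRule.

(** * Continuity and differentiation through multiplication by [A] *)

Section MatrixAction.
Context {R : realType} {m n : nat} (A : 'M[R]_(m, n)).

Lemma enorm_mulmx_le (u : 'cV[R]_n) : enorm (A *m u) <= `|sigma1 A| * enorm u.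
Proof.
rewrite -ler_sqr ?nnegrE ?mulr_ge0 ?enorm_ge0// exprMn !enorm_sqr.
by rewrite real_normK ?num_real// dotp_mulmx_le_sigma1.
Qed.

Lemma continuous_mulmx : continuous (fun u : 'cV[R]_n => A *m u).
Proof.
move=> u V /nbhs_enorm[e e0 eV].
have s0 : 0 < `|sigma1 A| + 1 by rewrite ltr_wpDl.
(* The dimension factor passes from the max norm of the ball to [enorm]; both increments by 1 keep
   the denominator positive and the final inequality strict. *)
pose d := e / ((`|sigma1 A| + 1) * n.+1%:R).
have d0 : 0 < d by rewrite divr_gt0// mulr_gt0.
apply/nbhs_ballP; exists d => // y [_ uy]; apply: eV; rewrite -mulmxBr.
apply: le_lt_trans (enorm_mulmx_le _) _.
have yu : enorm (y - u) <= n%:R * d.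
  apply: le_trans (ler_enorm_sum _ _) _.
  rewrite mulr_natl -[X in _ *+ X]card_ord -sumr_const.
  by apply: ler_sum => i _; have := uy i 0; rewrite /ball/= distrC !mxE => /ltW.
have <- : (`|sigma1 A| + 1) * (n.+1%:R * d) = e.
  by rewrite /d; field; rewrite !gt_eqF// nat1r ltr0n.
apply: (@le_lt_trans _ _ (`|sigma1 A| * (n%:R * d))); first by rewrite ler_wpM2l.
by rewrite -natr1; have := normr_ge0 (sigma1 A); have := ler0n R n; nra.
Qed.

Lemma abs_cont_mulmx (a b : R) (F : R -> 'cV[R]_n) :
  abs_cont a b F -> abs_cont a b (fun t => A *m F t).
Proof.
move=> acF; change (ac_incr a b (fun u v => enorm (A *m F v - A *m F u))).
apply: (ac_incr_le _ _ _ _ _ (ac_incrZ a b _ (fun u v => enorm (F v - F u))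
  (normr_ge0 (sigma1 A)) acF)) => u v _ _ _.
by rewrite -mulmxBr enorm_mulmx_le.
Qed.

Lemma is_derive_mulmx (F : R -> 'cV[R]_n) (t : R) (F' : 'cV[R]_n) :
  is_derive t 1 F F' -> is_derive t 1 (fun s => A *m F s) (A *m F').
Proof.
move=> dF.
have dAF i j : is_derive t 1 (fun s => (A *m F s) i j) ((A *m F') i j).
  have -> : (fun s => (A *m F s) i j) = \sum_(k < n) cst (A i k) * (fun s => F s k 0).
    by apply/funext => s; rewrite mxE fct_sumE; apply: eq_bigr => k _; rewrite ord1.
  rewrite mxE; apply: is_derive_eq.
    apply: is_derive_sum => k; apply: is_deriveM.
    exact: is_derive_entry.
  by apply: eq_bigr => k _; rewrite /GRing.scale/= mulr0 addr0 ord1.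
have dA : derivable (fun s => A *m F s) t 1.
  by apply/derivable_mxP => i j; case: (dAF i j).
apply: DeriveDef => //; rewrite derive_mx//.
by apply/matrixP => i j; rewrite !mxE derive_val mxE.
Qed.

End MatrixAction.

(** * Lyapunov functions *)

Lemma ae_impl {R : realType} (P Q : R -> Prop) : (forall t, P t -> Q t) ->
  {ae @lebesgue_measure R, forall t, P t} -> {ae @lebesgue_measure R, forall t, Q t}.
Proof.
by move=> PQ; apply: filterS => //; exact: (ae_filter_ringOfSetsType lebesgue_measure).
Qed.

Section Energy.
Context {R : realType} {m n : nat} (phi : 'cV[R]_n -> \bar R).
Local Notation mu := (@lebesgue_measure R).
Context (phiNy : forall x, (-oo < phi x)%E) (phi_lsc : lower_semicontinuous phi)
  (phi_growth : subgradient_growth phi).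
Context (A : 'M[R]_(m, n)) (alpha r : R) (alpha0 : 0 < alpha) (r0 : 0 < r).

(** The form <u, v>_M of the energies, with matrix M = alpha^-1 A^T A; the inclusion says that
    -M(X'' + r X') is a subgradient at X. *)
Definition kform (u v : 'cV[R]_n) : R := alpha^-1 * dotp (A *m u) (A *m v).

Lemma kformC u v : kform u v = kform v u.
Proof. by rewrite /kform dotpC. Qed.

Lemma kformDl u v w : kform (u + v) w = kform u w + kform v w.
Proof. by rewrite /kform mulmxDr dotpDl mulrDr. Qed.

Lemma kformZl k u v : kform (k *: u) v = k * kform u v.
Proof. by rewrite /kform -scalemxAr dotpZl; ring. Qed.

Lemma kformNl u v : kform (- u) v = - kform u v.
Proof. by rewrite -scaleN1r kformZl mulN1r. Qed.

Lemma kform0l u : kform 0 u = 0.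
Proof. by rewrite /kform mulmx0 dotp0l mulr0. Qed.

Lemma kform_ge0 u : 0 <= kform u u.
Proof. by rewrite mulr_ge0 ?dotp_ge0// invr_ge0 ltW. Qed.

(** The expansion of |k u + v|_M^2; it absorbs the mixed term <y, X'>_M in both energies. *)
Lemma kform_sqr_ge0 (k : R) u v :
  0 <= k ^+ 2 * kform u u + 2 * k * kform u v + kform v v.
Proof.
have := kform_ge0 (k *: u + v).
rewrite kformDl kformZl !(kformC _ (k *: u + v)) !kformDl !kformZl (kformC v u).
by nra.
Qed.

Lemma dotp_kform u v : dotp (alpha^-1 *: (A^T *m A *m u)) v = kform u v.
Proof. by rewrite dotpZl -mulmxA dotp_mulmx trmxK. Qed.

Lemma ac_kform (a b : R) (F G : R -> 'cV[R]_n) :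
  abs_cont a b F -> abs_cont a b G -> ac a b (fun t => kform (F t) (G t)).
Proof.
move=> acF acG; apply: (acM _ _ (fun=> alpha^-1)); first exact: ac_cst.
by apply: ac_dotp; exact: abs_cont_mulmx.
Qed.

Lemma is_derive_kform (F G : R -> 'cV[R]_n) (t : R) (F' G' : 'cV[R]_n) :
  is_derive t 1 F F' -> is_derive t 1 G G' ->
  is_derive t 1 (fun s => kform (F s) (G s)) (kform F' (G t) + kform (F t) G').
Proof.
move=> dF dG.
have dAFG := is_derive_dotp _ _ _ _ _ _ (is_derive_mulmx A _ _ _ dF)
  (is_derive_mulmx A _ _ _ dG).
apply: is_derive_eq (is_deriveM (is_derive_cst (alpha^-1 : R) t 1) dAFG) _.
by rewrite /GRing.scale/= mulr0 addr0 mulrDr.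
Qed.

Lemma ac_shift (a b : R) (F : R -> 'cV[R]_n) (c : 'cV[R]_n) :
  abs_cont a b F -> abs_cont a b (fun t => F t - c).
Proof.
move=> acF; change (ac_incr a b (fun u v => enorm ((F v - c) - (F u - c)))).
apply: (ac_incr_le _ _ _ (fun u v => enorm (F v - F u)) _ acF) => u v _ _ _.
by rewrite opprB addrA subrK.
Qed.

Context (xs : 'cV[R]_n) (hxs : minimizer phi xs) (xs_dom : edom phi xs).
Context (T : R) (X V : R -> 'cV[R]_n) (T0 : 0 < T).
Context (acX : abs_cont 0 T X) (acV : abs_cont 0 T V) (X0 : edom phi (X 0))
  (V0 : V 0 = 0).
Context (aeXV : {ae mu, forall t : R, 0 <= t <= T ->
  is_derive t 1 X (V t) /\ exists2 W : 'cV[R]_n, is_derive t 1 V W &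
    subdiff phi (X t) (- (alpha^-1 *: (A^T *m A *m (W + r *: V t))))}).

(** In the notation of the energies: Phi, |X'|_M^2, <y, X'>_M and |y|_M^2. *)
Let gap t := fine (phi (X t)) - fine (phi xs).
Let a t := kform (V t) (V t).
Let b t := kform (X t - xs) (V t).
Let c t := kform (X t - xs) (X t - xs).

Let aeX : {ae mu, forall t : R, 0 <= t <= T -> exists xi, subdiff phi (X t) xi}.
Proof. apply: ae_impl aeXV => t H /H[_ [W _ hxi]]; eexists; exact: hxi. Qed.

Let ac_gap : ac 0 T gap.
Proof.
have acp := ac_curve _ phiNy phi_lsc phi_growth _ _ T0 acX X0 aeX.
exact: acD acp (ac_cst _ _ (- fine (phi xs))).
Qed.

Let ac_a : ac 0 T a. Proof. exact: ac_kform. Qed.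
Let ac_b : ac 0 T b. Proof. by apply: ac_kform => //; exact: ac_shift. Qed.
Let ac_c : ac 0 T c. Proof. by apply: ac_kform; exact: ac_shift. Qed.

Let a_ge0 t : 0 <= a t. Proof. exact: kform_ge0. Qed.

Let curve_dom t : 0 <= t <= T -> edom phi (X t).
Proof. exact: edom_curve phiNy phi_lsc phi_growth _ _ T0 acX X0 aeX t. Qed.

Let gap_ge0 t : 0 <= t <= T -> 0 <= gap t.
Proof.
move=> /curve_dom Xt; rewrite subr_ge0 -lee_fin.
by rewrite -(edomE _ phiNy _ xs_dom) -(edomE _ phiNy _ Xt).
Qed.

(* Along a solution the energies only involve the scalars gap, a, b, c; of the
   acceleration only its products w1 and w2 with V and X - xs remain. *)
Lemma lyapunov_le (E : R -> R) : ac 0 T E ->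
  (forall t w1 w2 : R, 0 < t < T ->
    is_derive t 1 gap (- (w1 + r * a t)) -> is_derive t 1 a (2 * w1) ->
    is_derive t 1 b (a t + w2) -> is_derive t 1 c (2 * b t) ->
    (forall mu', mu' = 0 \/ strongly_convex mu' phi ->
      gap t + mu' / 2 * enorm (X t - xs) ^+ 2 + w2 + r * b t <= 0) ->
    exists2 D, is_derive t 1 E D & D <= 0) ->
  E T <= E 0.
Proof.
move=> acE HE; apply: ac_nonincreasing => //; first exact: ltW.
apply: ae_impl aeXV => t Ht /[dup] t0T /andP[t0 tT].
have tT' : 0 <= t <= T by rewrite !ltW.
have [dX [W dV hxi]] := Ht tT'.
have dy : is_derive t 1 (fun s => X s - xs) (V t).
  by apply: is_derive_eq (is_deriveB dX (is_derive_cst xs t 1)) _; rewrite subr0.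
apply: (HE t (kform W (V t)) (kform W (X t - xs))) => //.
- have dp := is_derive_curve _ phiNy phi_lsc phi_growth _ _ T0 acX X0 aeX _ _ _ t0T dX hxi.
  apply: is_derive_eq (is_deriveB dp (is_derive_cst (fine (phi xs)) t 1)) _.
  by rewrite subr0 dotpNl dotp_kform kformDl kformZl.
- apply: is_derive_eq (is_derive_kform _ _ _ _ _ dV dV) _.
  by rewrite (kformC (V t)); ring.
- apply: is_derive_eq (is_derive_kform _ _ _ _ _ dy dV) _.
  by rewrite (kformC _ W).
- apply: is_derive_eq (is_derive_kform _ _ _ _ _ dy dy) _.
  by rewrite (kformC (V t)) /b; ring.
(* The subgradient at [X t] is tested at [xs]; the case [mu' = 0] is the subgradient inequality
   itself. *)
- move=> mu' hmu.
  have : dotp (- (alpha^-1 *: (A^T *m A *m (W + r *: V t)))) (xs - X t) +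
      mu' / 2 * enorm (xs - X t) ^+ 2 <= - gap t.
    case: hmu => [->|hmu].
      by have := subdiff_le _ phiNy _ _ _ hxi xs_dom; rewrite /gap; lra.
    have := hmu _ _ _ hxi.1 xs_dom hxi.
    rewrite (edomE _ phiNy _ hxi.1) (edomE _ phiNy _ xs_dom) -EFinD lee_fin.
    by rewrite /gap; lra.
  rewrite dotpNl dotp_kform kformC -(opprB (X t)) kformNl enormN.
  rewrite kformC kformDl kformZl (kformC (V t)) -/(b t).
  by lra.
Qed.

(** * The two energies and the bounds at the final time *)

Let y0 := X 0 - xs.

Lemma convex_rate :
  T * gap T <= gap 0 / (2 * r) + r / 2 * kform y0 y0 + gap 0 / r.
Proof.
pose E := (id + cst (1 / (2 * r))) * (gap + cst (1 / 2) * a) + cst (r / 2) * c +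
  b + cst (1 / (2 * r)) * a + cst (1 / r) * gap.
have : E T <= E 0.
  apply: lyapunov_le.
    have acc (k : R) : ac 0 T (cst k) by exact: ac_cst.
    by repeat first [exact: ac_gap | exact: ac_a | exact: ac_b | exact: ac_c |
      exact: ac_id | exact: acc | apply: acD | apply: acM].
  move=> t w1 w2 /andP[t0 _] dgap da db dc ineq.
  (* The shift 1/(2r) cancels the |X'|_M^2 / 2 produced by differentiating the weight t, and Phi/r
     cancels the remaining [w1] and [a] terms of the square. What is left is the subgradient
     inequality and a damping term. *)
  exists (gap t - t * r * a t + r * b t + w2).
    have dk (k : R) := is_derive_cst k t 1.
    apply: is_derive_eq (is_deriveD (is_deriveD (is_deriveD (is_deriveD
      (is_deriveM (is_deriveD (is_derive_id t 1) (dk _))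
                  (is_deriveD dgap (is_deriveM (dk _) da)))
      (is_deriveM (dk _) dc)) db) (is_deriveM (dk _) da))
      (is_deriveM (dk _) dgap)) _.
    by rewrite /GRing.scale/= !fctE/=; field; rewrite gt_eqF.
  have := ineq 0 (or_introl erefl).
  have : 0 <= t * r * a t by apply: mulr_ge0 => //; apply: mulr_ge0; exact: ltW.
  by lra.
have -> : E 0 = gap 0 / (2 * r) + r / 2 * kform y0 y0 + gap 0 / r.
  rewrite /E !fctE/= /a /b /c V0 kform0l kformC kform0l.
  by field; rewrite gt_eqF.
have gapT : 0 <= gap T by rewrite gap_ge0// lexx ltW.
have -> : E T = (T + 1 / (2 * r)) * (gap T + 1 / 2 * a T) + r / 2 * c T + b T +
  1 / (2 * r) * a T + 1 / r * gap T by rewrite /E !fctE.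
move=> /(le_trans _); apply.
(* Everything in [E T] other than [T * gap T] is nonnegative. *)
have aT := a_ge0 T.
have : 0 <= r / 2 * c T + b T + 1 / (2 * r) * a T.
  have := kform_sqr_ge0 r (X T - xs) (V T); rewrite -/(a T) -/(b T) -/(c T) => H.
  have -> : r / 2 * c T + b T + 1 / (2 * r) * a T =
    (r ^+ 2 * c T + 2 * r * b T + a T) / (2 * r) by field; rewrite gt_eqF.
  by rewrite divr_ge0// ltW// mulr_gt0.
have : 0 <= T * (1 / 2 * a T) by apply: mulr_ge0; [exact: ltW|lra].
have : 0 <= 1 / (2 * r) * (gap T + 1 / 2 * a T).
  by apply: mulr_ge0; [rewrite divr_ge0// mulr_ge0// ltW|lra].
have : 0 <= 1 / r * gap T by apply: mulr_ge0 => //; rewrite divr_ge0// ltW.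
by lra.
Qed.

(** Quadratic growth at the minimizer, where 0 is a subgradient. *)
Let gap_strong mu' t : strongly_convex mu' phi -> 0 <= t <= T ->
  mu' / 2 * enorm (X t - xs) ^+ 2 <= gap t.
Proof.
move=> hmu /curve_dom Xt.
have sub0 : subdiff phi xs 0.
  split=> // y hy; rewrite dotp0l (edomE _ phiNy _ hy) (edomE _ phiNy _ xs_dom).
  rewrite -EFinB lee_fin subr_ge0 -lee_fin.
  by rewrite -(edomE _ phiNy _ hy) -(edomE _ phiNy _ xs_dom).
have := hmu _ _ _ xs_dom Xt sub0.
rewrite dotp0l add0r (edomE _ phiNy _ Xt) (edomE _ phiNy _ xs_dom) -EFinD lee_fin.
by rewrite /gap; lra.
Qed.

Lemma kform_le (mu' : R) z : 0 < mu' ->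
  r <= 3 * Num.sqrt (alpha * mu') / (2 * sigma1 A) ->
  (2 * r / 3) ^+ 2 * kform z z <= mu' * enorm z ^+ 2.
Proof.
move=> mu0 hr.
have am0 : 0 <= alpha * mu' by rewrite mulr_ge0// ltW.
(* Otherwise the bound on [r] would be at most 0, division by 0 giving 0, against [0 < r]. *)
have sig0 : 0 < sigma1 A.
  rewrite ltNge; apply/negP => sig0; have := lt_le_trans r0 hr.
  rewrite ltNge => /negP; apply; apply: mulr_ge0_le0.
    by rewrite mulr_ge0// sqrtr_ge0.
  by rewrite invr_le0; lra.
move: hr; rewrite ler_pdivlMr ?mulr_gt0// => hr.
have {}hr : (r * (2 * sigma1 A)) ^+ 2 <= (3 * Num.sqrt (alpha * mu')) ^+ 2.
  rewrite lerXn2r// nnegrE; first by rewrite mulr_ge0 ?mulr_ge0// ltW.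
  by rewrite mulr_ge0// sqrtr_ge0.
rewrite !exprMn sqr_sqrtr// in hr.
have -> : (2 * r / 3) ^+ 2 * kform z z =
  (2 * r / 3) ^+ 2 / alpha * dotp (A *m z) (A *m z) by rewrite /kform; ring.
have k0 : 0 <= (2 * r / 3) ^+ 2 / alpha by rewrite divr_ge0 ?sqr_ge0// ltW.
apply: le_trans (ler_wpM2l k0 (dotp_mulmx_le_sigma1 _ _ A z)) _.
rewrite mulrA enorm_sqr ler_wpM2r ?dotp_ge0// mulrAC ler_pdivrMr//.
by lra.
Qed.

Lemma ac_expR (k : R) : 0 <= k -> ac 0 T (expR \o (cst k * id)).
Proof.
move=> k0; have M0 : 0 <= k * expR (k * T) by rewrite mulr_ge0 ?expR_ge0.
apply: (ac_incr_le _ _ _ _ _ (ac_incrZ _ _ _ _ M0 (ac_id 0 T))) => u v u0 uv vT /=.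
have kuv : k * u <= k * v by rewrite ler_wpM2l.
rewrite !ger0_norm ?subr_ge0 ?ler_expR// -mulrA mulrCA.
apply: (@le_trans _ _ (expR (k * v) * (k * (v - u)))); last first.
  rewrite ler_wpM2r ?ler_expR ?ler_wpM2l// mulr_ge0// subr_ge0//.
(* Convexity of the exponential: its chord is no steeper than the tangent at the right end. *)
have := expR_ge1Dx (k * u - k * v).
rewrite -(ler_pM2l (expR_gt0 (k * v))) -expRD subrKC.
by lra.
Qed.

Lemma strongly_convex_rate (mu' : R) : 0 < mu' -> strongly_convex mu' phi ->
  r <= 3 * Num.sqrt (alpha * mu') / (2 * sigma1 A) ->
  mu' / 4 * enorm (X T - xs) ^+ 2 <=
    (gap 0 + r ^+ 2 / 9 * kform y0 y0) * expR (- (2 * r * T / 3)).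
Proof.
move=> mu0 hmu hr; pose k := 2 * r / 3.
have k0 : 0 <= k by rewrite divr_ge0// mulr_ge0// ltW.
have kle t : k ^+ 2 * c t <= mu' * enorm (X t - xs) ^+ 2 by exact: kform_le.
pose E := (expR \o (cst k * id)) *
  (gap + cst (k ^+ 2 / 4) * c + cst k * b + cst (1 / 2) * a).
have : E T <= E 0.
  apply: lyapunov_le.
    have acc (l : R) : ac 0 T (cst l) by exact: ac_cst.
    by repeat first [exact: ac_gap | exact: ac_a | exact: ac_b | exact: ac_c |
      exact: ac_expR | exact: acc | apply: acD | apply: acM].
  move=> t w1 w2 /andP[t0 _] dgap da db dc ineq.
  (* Before simplification [a] has coefficient 3k/2 - r, which vanishes for k = 2r/3, and [b] has
     3k^2/2 = k r, the multiple appearing in [ineq]; the [w1] terms cancel. *)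
  exists (expR (k * t) * (k * (gap t + k ^+ 2 / 4 * c t + w2 + r * b t))).
    have dk (l : R) := is_derive_cst l t 1.
    have dexp := is_derive1_comp (is_derive_expR _)
      (is_deriveM (dk k) (is_derive_id t 1)).
    apply: is_derive_eq (is_deriveM dexp (is_deriveD (is_deriveD (is_deriveD
      dgap (is_deriveM (dk _) dc)) (is_deriveM (dk _) db))
      (is_deriveM (dk _) da))) _.
    by rewrite /GRing.scale/= !fctE/= /k; field.
  rewrite mulr_ge0_le0 ?expR_ge0// mulr_ge0_le0//.
  (* Strong convexity supplies -mu'/2 |y|^2, of which the [c] term uses at most half. *)
  have := ineq mu' (or_intror hmu); have := kle t.
  by have : 0 <= mu' * enorm (X t - xs) ^+ 2; [rewrite mulr_ge0 ?sqr_ge0// ltW|lra].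
have -> : E 0 = gap 0 + r ^+ 2 / 9 * kform y0 y0.
  rewrite /E !fctE/= mulr0 expR0 /a /b /c V0 kform0l kformC kform0l /k.
  by field.
have -> : E T = expR (k * T) * (gap T + k ^+ 2 / 4 * c T + k * b T + 1 / 2 * a T).
  by rewrite /E !fctE.
have -> : - (2 * r * T / 3) = - (k * T) by rewrite /k; ring.
rewrite expRN ler_pdivlMr ?expR_gt0// => ET; apply: le_trans ET.
rewrite mulrC ler_pM2l ?expR_gt0//.
have T0T : 0 <= T <= T by rewrite lexx ltW.
(* The terms after [gap] equal |k y + X'|_M^2 / 2 - k^2/4 |y|_M^2, so they take away at most half of
   the quadratic growth; this leaves mu'/4. *)
have := gap_strong _ _ hmu T0T; have := kle T.
have := kform_sqr_ge0 k (X T - xs) (V T); rewrite -/(a T) -/(b T) -/(c T).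
by lra.
Qed.

End Energy.

(** * Transfer to the composite objective and to every time of the interval *)

Lemma minimizer_minval (R : realType) n (h : 'cV[R]_n -> \bar R) xs :
  minimizer h xs -> minval h = h xs.
Proof.
move=> hxs; apply/eqP; rewrite eq_le; apply/andP; split.
  by apply: ereal_inf_lbound; exists xs.
by apply: le_ereal_inf_tmp => _ [y _ <-]; exact: hxs.
Qed.

Lemma composite_setting_lsc (R : realType) m n (f : 'cV[R]_n -> \bar R)
    (g : 'cV[R]_m -> \bar R) (A : 'M[R]_(m, n)) :
  composite_setting f g A ->
  (forall x, -oo < composite f g A x)%E /\ lower_semicontinuous (composite f g A).
Proof.
move=> [[[fNy _] _ flsc _] [[gNy _] _ glsc _] _ _ _]; split=> [x|].
  rewrite /composite; move: (fNy x) (gNy (A *m x)).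
  by case: (f x) => [y| |]//; case: (g _) => [z| |]// _ _; rewrite -EFinD ltNyr.
apply: (lower_semicontinuousD _ f (g \o mulmx A)) => // [x|]; first exact: gNy.
by apply: lower_semicontinuous_comp => //; exact: continuous_mulmx.
Qed.

(** The energy bounds concern the final time; restricting a solution turns any positive t of the
    interval into one. *)
Lemma solution_restrict (R : realType) m n (phi : 'cV[R]_n -> \bar R)
    (A : 'M[R]_(m, n)) (alpha r : R) x0 (T t : R) X : t <= T ->
  solution phi A alpha r x0 T X -> solution phi A alpha r x0 t X.
Proof.
move=> tT [V [acX acV X0 V0 ae]]; exists V; split=> //.
- exact: (ac_incr_sub 0 T 0 t (fun u v => enorm (X v - X u)) (lexx 0) tT acX).
- exact: (ac_incr_sub 0 T 0 t (fun u v => enorm (V v - V u)) (lexx 0) tT acV).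
- apply: ae_impl ae => s H /andP[s0 st]; apply: H.
  by rewrite s0 (le_trans st).
Qed.

Theorem proposition14 (R : realType) (m n : nat)
    (f : 'cV[R]_n -> \bar R) (g : 'cV[R]_m -> \bar R) (A : 'M[R]_(m, n))
    (hS1 : composite_setting f g A)
    (hS2 : subgradient_growth (composite f g A))
    (alpha r : R) (halpha : 0 < alpha) (hr : 0 < r)
    (x0 : 'cV[R]_n) (hx0 : edom (composite f g A) x0)
    (xstar : 'cV[R]_n) (hxstar : minimizer (composite f g A) xstar) :
  (convex_ext (composite f g A) ->
    exists C : R, 0 < C /\
      forall (T : R) (X : R -> 'cV[R]_n), 0 <= T ->
        solution (composite f g A) A alpha r x0 T X ->
        {ae (@lebesgue_measure R), forall t : R, 0 <= t <= T -> 1 / r <= t ->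
          (composite f g A (X t) - minval (composite f g A)
             <= (C / (alpha * t))%R%:E)%E})
  /\
  (forall mu : R, 0 < mu -> strongly_convex mu (composite f g A) ->
    r <= 3 * Num.sqrt (alpha * mu) / (2 * sigma1 A) ->
    exists C : R, 0 < C /\
      forall (T : R) (X : R -> 'cV[R]_n), 0 <= T ->
        solution (composite f g A) A alpha r x0 T X ->
        {ae (@lebesgue_measure R), forall t : R, 0 <= t <= T ->
          enorm (X t - xstar) ^+ 2 <= C / mu * expR (- (2 * r * t / 3))}).
Proof.
have [phiNy phi_lsc] := composite_setting_lsc _ _ _ _ _ _ hS1.
have hxs : edom (composite f g A) xstar by exact: le_lt_trans (hxstar x0) hx0.
rewrite (minimizer_minval _ _ _ _ hxstar).
set phi := composite f g A in hS2 hx0 hxstar phiNy phi_lsc hxs *.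
pose G0 := fine (phi x0) - fine (phi xstar).
pose K0 := kform A alpha (x0 - xstar) (x0 - xstar).
have G00 : 0 <= G0.
  rewrite subr_ge0 -lee_fin -(edomE _ phiNy _ hx0) -(edomE _ phiNy _ hxs).
  exact: hxstar.
have K00 : 0 <= K0 by exact: kform_ge0.
split=> [_|mu mu0 hmu hrmu].
  pose S := G0 / (2 * r) + r / 2 * K0 + G0 / r.
  have S0 : 0 <= S.
    apply: addr_ge0; last by rewrite divr_ge0// ltW.
    apply: addr_ge0; first by rewrite divr_ge0// mulr_ge0// ltW.
    by rewrite mulr_ge0// divr_ge0// ltW.
  (* [S] depends only on the data and [x0], so the constant is chosen before [T] and [X]; the [+ 1]
     makes it positive. *)
  exists (alpha * S + 1); split; first by rewrite ltr_wpDl// mulr_ge0// ltW.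
  move=> T X _ sol; apply: aeW => t /andP[_ tT] rt.
  have t0 : 0 < t by apply: lt_le_trans rt; rewrite divr_gt0.
  have [V [acX acV X0 V0 ae]] := solution_restrict _ _ _ _ _ _ _ _ _ _ _ tT sol.
  have phiX0 : edom phi (X 0) by rewrite X0.
  have Xt : edom phi (X t).
    apply: (edom_curve phi phiNy phi_lsc hS2 t X t0 acX phiX0).
      by apply: ae_impl ae => s H /H[_ [W _ hxi]]; eexists; exact: hxi.
    by rewrite lexx ltW.
  have := convex_rate phi phiNy phi_lsc hS2 A alpha r halpha hr xstar hxstar hxs
    t X V t0 acX acV phiX0 V0 ae.
  rewrite X0 -/G0 -/K0 -/S => HS.
  rewrite (edomE _ phiNy _ Xt) (edomE _ phiNy _ hxs) -EFinB lee_fin.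
  by rewrite ler_pdivlMr ?mulr_gt0//; nra.
pose S := G0 + r ^+ 2 / 9 * K0.
have S0 : 0 <= S by rewrite addr_ge0// mulr_ge0// divr_ge0// sqr_ge0.
(* The factor 4 clears the mu/4 of the energy bound. *)
exists (4 * S + 1); split; first by rewrite ltr_wpDl// mulr_ge0.
(* Time 0 is the exceptional set, since the energy bound is for an interval of positive length. *)
move=> T X _ sol; exists [set 0]; split=> //; first exact: lebesgue_measure_set1.
move=> t /= /not_implyP[/andP[t_ge0 tT] Ht].
apply: contrapT => /eqP t_neq0; apply: Ht.
have t0 : 0 < t by rewrite lt_neqAle eq_sym t_neq0.
have [V [acX acV X0 V0 ae]] := solution_restrict _ _ _ _ _ _ _ _ _ _ _ tT sol.
have phiX0 : edom phi (X 0) by rewrite X0.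
have := strongly_convex_rate phi phiNy phi_lsc hS2 A alpha r halpha hr
  xstar hxstar hxs t X V t0 acX acV phiX0 V0 ae mu mu0 hmu hrmu.
rewrite X0 -/G0 -/K0 -/S => HS.
rewrite mulrAC ler_pdivlMr// mulrC.
have := expR_ge0 (- (2 * r * t / 3)); nra.
Qed.
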